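(* Let $M$ be a compact, smooth, connected manifold of dimension $n\geq 4$ and let $l\in\{2,\ldots,n-1\}$. Let $\{g_s\}_{s\geq 0}$ be a smooth family of Riemannian metrics on $M$, and let $R^s$ be the curvature tensor of $g_s$. Let $\mathcal{P}_0$ be the set of partially geodesic $l$-planes for $g_0$, and suppose that for all $k\in\{l+1,\ldots,n-1\}$, $g_0$ has no partially geodesic $k$-planes. Suppose further that there are $c,s_0>0$ and a neighborhood $\mathcal{U}_0$ of $\mathcal{P}_0$ in the Grassmannian $\mathcal{G}_l(M)$ of $l$-planes tangent to $M$ so that for every $P\in\mathcal{U}_0$, every $s\in(0,s_0)$, and some $g_0$-unit $v\in P$, $$\mathcal{I}_{R^s_v}(P)>cs.$$ Then for all sufficiently small $s>0$ and all $k\in\{l,\ldots,n-1\}$, $(M,g_s)$ has no partially geodesic $k$-planes.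
   Context: For a self adjoint linear map $\Phi:V\to V$ of a finite-dimensional inner product space $V$ and a subspace $W\subset V$, set $$\mathcal{I}_{\Phi}(W)=\max_{\{w\in W:\ |w|=1\}}\left|\Phi(w)^{W^{\perp}}\right|,$$ where $\Phi(w)^{W^\perp}$ is the component of $\Phi(w)$ perpendicular to $W$. For a Riemannian manifold $(M,g)$ with curvature tensor $R$ and $v\in T_pM$, the Jacobi operator is the $g$-self adjoint map $R_v=R(\cdot,v)v:T_pM\to T_pM$. For the metric $g_s$, the quantity $\mathcal{I}_{R^s_v}(P)$ is computed using the inner product $g_s$. For $k\in\{2,3,\ldots,n-1\}$, a $k$-plane $P\subset T_pM$ tangent to a Riemannian $n$-manifold is called partially geodesic if and only if $\mathcal{I}_{R_v}(P)=0$ for all $v\in P$. *)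

(* Defs.v *)
From HB Require Import structures.
From mathcomp Require Import all_boot all_order all_algebra.
From mathcomp Require Import all_classical all_reals all_analysis.

Set Implicit Arguments.
Unset Strict Implicit.
Unset Printing Implicit Defensive.

Import Order.TTheory GRing.Theory Num.Theory.
Import numFieldNormedType.Exports.

Local Open Scope classical_set_scope.
Local Open Scope ring_scope.

Section Smoothness.
Context {R : realType} {V : normedModType R}.

(* For finite-dimensional V and open U this is the usual C^k: all iterated
   directional derivatives of order at most k exist and are continuous on U. *)
Fixpoint Ck (k : nat) (U : set V) (f : V -> R) : Prop :=
  (forall x, U x -> {for x, continuous f}) /\
  if k is k'.+1 then
    forall v, (forall x, U x -> derivable f x v) /\ Ck k' U ('D_v f)
  else True.

(* Smoothness on an arbitrary subset A: f extends, near each point of A, to a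
   C^infinity function on an open set.  The non-open case used below is
   [0, +oo[ x (open set). *)
Definition smooth_on (A : set V) (f : V -> R) : Prop :=
  forall x, A x -> exists (U : set V) (F : V -> R),
    [/\ open U, U x, forall k, Ck k U F & forall y, A y -> U y -> F y = f y].

End Smoothness.

(* Only the values of chart_fun on chart_dom, and those of chart_inv on
   chart_codom, are meaningful. *)
Record chart (R : realType) (n : nat) (M : topologicalType) := Chart {
  chart_dom : set M;
  chart_codom : set 'rV[R]_n;
  chart_fun :> M -> 'rV[R]_n;
  chart_inv : 'rV[R]_n -> M;
  chart_dom_open : open chart_dom;
  chart_codom_open : open chart_codom;
  chart_funP : forall p, chart_dom p -> chart_codom (chart_fun p);
  chart_invP : forall x, chart_codom x -> chart_dom (chart_inv x);
  chart_funK : forall p, chart_dom p -> chart_inv (chart_fun p) = p;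
  chart_invK : forall x, chart_codom x -> chart_fun (chart_inv x) = x;
  chart_fun_cts : forall p, chart_dom p -> {for p, continuous chart_fun};
  chart_inv_cts : forall x, chart_codom x -> {for x, continuous chart_inv} }.

Definition transition (R : realType) (n : nat) (M : topologicalType)
    (c d : chart R n M) : 'rV[R]_n -> 'rV[R]_n :=
  fun x => d (chart_inv c x).

(* The atlas need not be maximal. *)
Record manifold (R : realType) (n : nat) := Manifold {
  carrier :> topologicalType;
  carrier_hausdorff : hausdorff_space carrier;
  carrier_second_countable : @second_countable carrier;
  atlas : set (chart R n carrier);
  atlas_cover : forall p, exists2 c, atlas c & chart_dom c p;
  atlas_smooth : forall c d, atlas c -> atlas d -> forall i,
    smooth_on [set x | chart_codom c x /\ chart_dom d (chart_inv c x)]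
      (fun x => transition c d x 0 i) }.

Section Manifold.
Context {R : realType} {n : nat} {M : manifold R n}.

Definition chart_at (p : M) : chart R n M := projT1 (cid2 (atlas_cover p)).

(* The tangent space at p is the space of coordinate vectors with respect to
   the chosen chart [chart_at p]; [tcoord c v] and [tbasis c p i] convert to
   and from the coordinates given by another chart c around p.  Vectors are
   rows, so that 'J f x acts on the right. *)
Definition tangent (p : M) : vectType R := 'rV[R]_n.

Definition tcoord (c : chart R n M) (p : M) (v : tangent p) : 'rV[R]_n :=
  (v : 'rV[R]_n) *m 'J (transition (chart_at p) c) (chart_at p p).

Definition tbasis (c : chart R n M) (p : M) (i : 'I_n) : tangent p :=
  row i ('J (transition c (chart_at p)) (c p)).

Definition gram (g : forall p : M, tangent p -> tangent p -> R)
    (c : chart R n M) (x : 'rV[R]_n) : 'M[R]_n :=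
  \matrix_(i, j) g (chart_inv c x) (tbasis c (chart_inv c x) i)
                                   (tbasis c (chart_inv c x) j).

End Manifold.

Record metric (R : realType) (n : nat) (M : manifold R n) := Metric {
  inner :> forall p : M, tangent p -> tangent p -> R;
  inner_linear : forall p (a : R) (u v w : tangent p),
    inner (a *: u + v) w = a * inner u w + inner v w;
  inner_sym : forall p (u v : tangent p), inner u v = inner v u;
  inner_pos : forall p (u : tangent p), u != 0 -> 0 < inner u u;
  inner_smooth : forall c, atlas c -> forall i j,
    smooth_on (chart_codom c) (fun x => gram inner c x i j) }.

(* Joint smoothness on [0, +oo[ x M; nothing is asked of g s for s < 0. *)
Definition smooth_family (R : realType) (n : nat) (M : manifold R n)
    (g : R -> metric M) : Prop :=
  forall c, atlas c -> forall i j,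
    smooth_on [set sx : R * 'rV[R]_n | 0 <= sx.1 /\ chart_codom c sx.2]
      (fun sx => gram (g sx.1) c sx.2 i j).

Section LocalCurvature.
Context {R : realType} {n : nat}.
Implicit Types (G : 'rV[R]_n -> 'M[R]_n) (x : 'rV[R]_n).

Definition partial (i : 'I_n) (f : 'rV[R]_n -> R) : 'rV[R]_n -> R :=
  'D_(delta_mx 0 i) f.

(* Gamma^k_{ij} *)
Definition christoffel G (k i j : 'I_n) x : R :=
  2^-1 * \sum_l invmx (G x) k l *
    (partial i (fun y => G y j l) x + partial j (fun y => G y i l) x
     - partial l (fun y => G y i j) x).

(* R(d_i, d_j) d_k = \sum_l (riemann G l i j k) d_l, with
   R(X, Y) Z = nabla_X nabla_Y Z - nabla_Y nabla_X Z - nabla_[X, Y] Z. *)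
Definition riemann G (l i j k : 'I_n) x : R :=
  partial i (christoffel G l j k) x - partial j (christoffel G l i k) x
  + \sum_m (christoffel G m j k x * christoffel G l i m x
            - christoffel G m i k x * christoffel G l j m x).

End LocalCurvature.

Section Curvature.
Context {R : realType} {n : nat} {M : manifold R n}.

Definition tensor13 :=
  forall p : M, tangent p -> tangent p -> tangent p -> tangent p.

(* Rm is the curvature tensor of g: its components in every chart are given by
   the classical expression in the metric coefficients.  Since that expression
   is tensorial, exactly one Rm satisfies this. *)
Definition curvature_tensor (g : metric M) (Rm : tensor13) : Prop :=
  forall c, atlas c -> forall p, chart_dom c p -> forall u v w : tangent p,
    tcoord c (Rm p u v w) =
    \sum_i \sum_j \sum_k
      (tcoord c u 0 i * tcoord c v 0 j * tcoord c w 0 k) *: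
      \row_l riemann (gram g c) l i j k (c p).

Definition jacobi (Rm : tensor13) (p : M) (v : tangent p) :
  tangent p -> tangent p := fun u => Rm p u v v.

End Curvature.
Arguments tensor13 {R n} M.

Section Invariance.
Context {R : realType} {V : vectType R}.

Definition perp_part (ip : V -> V -> R) (W : {vspace V}) (u : V) : V :=
  xget 0 [set y | u - y \in W /\ forall w, w \in W -> ip w y = 0].

(* The supremum is a maximum, by compactness, whenever W != 0. *)
Definition calI (ip : V -> V -> R) (Phi : V -> V) (W : {vspace V}) : R :=
  sup [set Num.sqrt (ip (perp_part ip W (Phi w)) (perp_part ip W (Phi w)))
      | w in [set w | w \in W /\ ip w w = 1]].

End Invariance.

(* The Grassmannian of k-planes tangent to M. *)
Record plane (R : realType) (n : nat) (M : manifold R n) (k : nat) := Plane {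
  foot : M;
  plane_space : {vspace tangent foot};
  dim_plane : \dim plane_space = k }.

Section Grassmannian.
Context {R : realType} {n : nat} {M : manifold R n} {k : nat}.
Implicit Types (P Q : plane M k) (c : chart R n M) (A : 'M[R]_(k, n)).

Definition frame c P A : Prop :=
  exists2 b : k.-tuple (tangent (foot P)), basis_of (plane_space P) b &
    forall i, row i A = tcoord c (tnth b i).

(* The manifold topology of the Grassmannian: over the domain of a chart c it
   is the quotient topology of the pairs (coordinates of the foot point,
   coordinates of a frame). *)
Definition plane_open (U : set (plane M k)) : Prop :=
  forall c, atlas c -> forall P A, U P -> chart_dom c (foot P) -> frame c P A ->
    \forall xB \near (c (foot P), A), forall Q,
      chart_dom c (foot Q) -> c (foot Q) = xB.1 -> frame c Q xB.2 -> U Q.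

Lemma plane_openT : plane_open setT.
Proof. by move=> c _ P A _ _ _; near=> xB. Unshelve. all: by end_near. Qed.

Lemma plane_openI : setI_closed plane_open.
Proof.
move=> U W oU oW c cM P A [UP WP] cP fA.
by near=> xB => Q cQ xQ fQ; split; move: Q cQ xQ fQ; near: xB;
  [exact: oU|exact: oW].
Unshelve. all: by end_near. Qed.

Lemma plane_open_bigU (I : Type) (f : I -> set (plane M k)) :
  (forall i, plane_open (f i)) -> plane_open (\bigcup_i f i).
Proof.
move=> of_ c cM P A [i _ fiP] cP fA.
have := of_ i c cM P A fiP cP fA.
by apply: filterS => xB h Q cQ xQ fQ; exists i => //; exact: h.
Qed.

HB.instance Definition _ := gen_eqMixin (plane M k).
HB.instance Definition _ := gen_choiceMixin (plane M k).
HB.instance Definition _ := isOpenTopological.Build (plane M k)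
  plane_openT plane_openI plane_open_bigU.

End Grassmannian.

Definition partially_geodesic (R : realType) (n : nat) (M : manifold R n)
    (g : metric M) (Rm : tensor13 M) (k : nat) (P : plane M k) : Prop :=
  forall v, v \in plane_space P ->
    calI (@inner _ _ _ g (foot P)) (jacobi Rm v) (plane_space P) = 0.

(* Main.v *)
Require Import Defs.
From HB Require Import structures.
From mathcomp Require Import all_boot all_order all_algebra.
From mathcomp Require Import all_classical all_reals all_analysis.
From mathcomp Require Import ring lra.
Set Implicit Arguments.
Unset Strict Implicit.
Unset Printing Implicit Defensive.
Import Order.TTheory GRing.Theory Num.Theory.
Import numFieldNormedType.Exports.
Local Open Scope classical_set_scope.
Local Open Scope ring_scope.

(** Whether a plane is partially geodesic is an algebraic condition on the
    curvature: the calI of the Jacobi operator R_v vanishes on P exactly when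
    R_v maps P into itself ([calI_eq0]), so P is partially geodesic if and only
    if R(w, v)v lies in P for all v, w in P.  In a chart, with P given by the
    coordinates x of its foot point and a k x n matrix A whose rows are the
    coordinates of a basis of P, this says that certain row vectors
    [curv_form] built from the components of the curvature lie in the row space
    of A ([partially_geodesicP]).  Those components depend continuously on (s, x)
    up to s = 0 ([cvg_riemann]), and lying outside the row space of a row-free
    matrix is the nonvanishing of a Gram determinant.  Hence, if P is not
    partially geodesic for g_0, no plane close to P is partially geodesic for
    g_s with s > 0 small ([not_geodesic_stable]).

    Consider now k between l and n - 1 and any k-plane P.  If P is not partially
    geodesic for g_0, the previous remark applies to the planes close to P.  If
    it is, then k = l, because g_0 has no larger partially geodesic planes, and
    the planes close to P lie in U_0, where calI > c s > 0 for some v forbids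
    them to be partially geodesic for g_s.  So every plane has a neighbourhood,
    and a bound on s, for which the conclusion holds, and compactness of the
    Grassmannian of k-planes makes the bound uniform.  Compactness is used in
    two stages: over a point of M, every plane has a frame in one of finitely
    many compact sets of matrices ([normalise], [normalised_compact]); then M
    itself is compact.

    Two facts of calculus enter.  The Jacobian matrices of a transition map and
    of its inverse are inverse to each other ([jacobian_transitionK]), which makes
    coordinates of tangent vectors meaningful and the matrix of the metric
    invertible; it rests on the chain rule, hence on the differentiability of
    functions with continuous partial derivatives ([differentiable_partials]).
    And the Christoffel symbols of the family extend to C^1 functions on a full
    neighbourhood of (0, x), so that the x-derivatives in the curvature are
    values of continuous functions of (s, x) ([riemann_extension]). *)

(** * Continuous partial derivatives give differentiability *)

Lemma cvg_sumr (R : realType) (T I : Type) (F : set_system T) (FF : Filter F)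
    (r : seq I) (P : pred I) (f : I -> T -> R) (l : I -> R) :
  (forall i, P i -> f i x @[x --> F] --> l i) ->
  \sum_(i <- r | P i) f i x @[x --> F] --> \sum_(i <- r | P i) l i.
Proof. by apply: cvg_big; exact: add_continuous. Qed.

Lemma cvg_prodr (R : realType) (T I : Type) (F : set_system T) (FF : Filter F)
    (r : seq I) (P : pred I) (f : I -> T -> R) (l : I -> R) :
  (forall i, P i -> f i x @[x --> F] --> l i) ->
  \prod_(i <- r | P i) f i x @[x --> F] --> \prod_(i <- r | P i) l i.
Proof. by apply: cvg_big; exact: mul_continuous. Qed.

Lemma differentiable_increment (R : realType) (V W : normedModType R)
    (f : V -> W) (df : {linear V -> W}) (x : V) : continuous df ->
  (forall e, 0 < e -> \forall h \near 0, `|f (h + x) - f x - df h| <= e * `|h|) ->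
  differentiable f x.
Proof.
move=> cdf H.
have E : f \o shift x = cst (f x) + df +o_ 0 id.
  apply/eqaddoP => e e0; have := H e e0; apply: filterS => h.
  by rewrite !fctE /= opprD addrA.
by apply/diff_locallyP; rewrite (diff_unique cdf E).
Qed.

Section ContinuousPartials.
Context {R : realType} {n : nat}.
Implicit Types (f : 'rV[R]_n -> R) (x y h v : 'rV[R]_n).

Lemma is_derive_line f y v (t : R) : derivable f (t *: v + y) v ->
  is_derive t 1 (fun s : R => f (s *: v + y)) ('D_v f (t *: v + y)).
Proof.
move=> df; have E : (fun h : R => h^-1 *: (((fun s : R => f (s *: v + y)) \o
      shift t) (h *: 1) - f (t *: v + y))) =
    (fun h : R => h^-1 *: ((f \o shift (t *: v + y)) (h *: v) - f (t *: v + y))).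
  by apply/funext => h /=; rewrite [h *: 1]mulr1 scalerDl addrA.
by split; rewrite /derivable /derive E.
Qed.

(** The mean value theorem along a line. *)
Lemma line_increment_ge0 f y v (t D e : R) : 0 <= t ->
  (forall s, 0 <= s <= t -> derivable f (s *: v + y) v /\
     `|'D_v f (s *: v + y) - D| <= e) ->
  `|f (t *: v + y) - f y - t * D| <= t * e.
Proof.
move=> t0 H.
have H' s : s \in `[0, t] ->
    is_derive s 1 (fun s : R => f (s *: v + y)) ('D_v f (s *: v + y)).
  by rewrite in_itv /= => /H[? _]; exact: is_derive_line.
have [c cin] := @MVT_segment R (fun s : R => f (s *: v + y))
    (fun s => 'D_v f (s *: v + y)) 0 t t0
    (fun s hs => H' s (subset_itv_oo_cc hs))
    (derivable_within_continuous (fun s hs => @ex_derive _ _ _ _ _ _ _ (H' s hs))).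
rewrite scale0r add0r subr0 => ->.
rewrite mulrC -mulrBr normrM ger0_norm// ler_wpM2l//.
by apply: (H c _).2; move: cin; rewrite in_itv.
Qed.

Lemma line_increment f y v (t D e : R) :
  (forall s, `|s| <= `|t| -> derivable f (s *: v + y) v /\
     `|'D_v f (s *: v + y) - D| <= e) ->
  `|f (t *: v + y) - f y - t * D| <= `|t| * e.
Proof.
move=> H; have [t0|t0] := leP 0 t.
  rewrite (ger0_norm t0); apply: line_increment_ge0 => // s /andP[s0 st].
  by apply: H; rewrite !ger0_norm.
(* for negative t the segment is run through from its other end *)
have E : - t *: v + (t *: v + y) = y by rewrite addrA -scalerDl addNr scale0r add0r.
have -> : f (t *: v + y) - f y - t * D =
    - (f (- t *: v + (t *: v + y)) - f (t *: v + y) - (- t) * D).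
  by rewrite E; ring.
rewrite normrN (ltr0_norm t0); apply: line_increment_ge0; first by rewrite oppr_ge0 ltW.
move=> s /andP[s0 st]; rewrite addrA -scalerDl; apply: H.
by rewrite (ltr0_norm t0) ler_norml opprK; apply/andP; split; lra.
Qed.

Let trunc (k : nat) h : 'rV[R]_n := \row_j (if (j < k)%N then h 0 j else 0).

Lemma coord_norm_le (v : 'rV[R]_n) j : `|v 0 j| <= `|v|.
Proof. by rewrite [leRHS]/Num.Def.normr/= mx_normrE; exact: (le_bigmax _ _ (ord0, j)). Qed.

Lemma norm_le_coord (v : 'rV[R]_n) (e : R) : 0 <= e ->
  (forall j, `|v 0 j| <= e) -> `|v| <= e.
Proof.
move=> e0 H; rewrite [leLHS]/Num.Def.normr/= mx_normrE; apply: bigmax_le => //= -[i j] _.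
by rewrite ord1.
Qed.

(** From x to h + x along the edges of a box, one coordinate at a time: [trunc k h]
    keeps the first k coordinates of h, and every edge stays within the norm
    of h of the point x. *)
Lemma increment_bound f x h (D : 'I_n -> R) (e d : R) : `|h| < d ->
  (forall y i, `|y| < d -> derivable f (y + x) (delta_mx 0 i) /\
     `|'D_(delta_mx 0 i) f (y + x) - D i| <= e) ->
  `|f (h + x) - f x - \sum_i h 0 i * D i| <= n%:R * (`|h| * e).
Proof.
move=> hd H.
have K k : (k <= n)%N ->
  `|f (trunc k h + x) - f x - \sum_(i < n | (i < k)%N) h 0 i * D i|
     <= k%:R * (`|h| * e).
  elim: k => [_|k IH kn].
    rewrite big1// subr0 mul0r (_ : trunc 0 h = 0) ?add0r ?subrr ?normr0//.
    by apply/rowP => j; rewrite !mxE.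
  pose i := Ordinal kn.
  have T1 : trunc k.+1 h = h 0 i *: delta_mx 0 i + trunc k h.
    apply/rowP => j; rewrite !mxE eqxx /= ltnS leq_eqVlt -val_eqE /=.
    have [/val_inj ->/=|jk] := eqVneq (val j) (val i); last by rewrite mulr0 add0r.
    by rewrite ltnn mulr1 addr0.
  rewrite (bigD1 i)/= ?ltnS//.
  rewrite (eq_bigl (fun j : 'I_n => (j < k)%N)); last first.
    by move=> j; rewrite ltnS ltn_neqAle andbC -val_eqE.
  set S := \sum_(_ < n | _) _ in IH *.
  have -> : f (trunc k.+1 h + x) - f x - (h 0 i * D i + S) =
     (f (h 0 i *: delta_mx 0 i + (trunc k h + x)) - f (trunc k h + x)
        - h 0 i * D i) + (f (trunc k h + x) - f x - S).
    by rewrite T1 -(addrA (h 0 i *: _)); ring.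
  rewrite -natr1 mulrDl mul1r [leRHS]addrC.
  apply: le_trans (ler_normD _ _) _; apply: lerD; last exact/IH/ltnW.
  have e0 : 0 <= e.
    have /H : `|0 : 'rV[R]_n| < d by rewrite normr0 (le_lt_trans _ hd).
    by move=> /(_ i)[_]; apply: le_trans.
  apply: (@le_trans _ _ (`|h 0 i| * e)); last by rewrite ler_wpM2r ?coord_norm_le.
  apply: line_increment => s sh; rewrite addrA; apply: H.
  apply: le_lt_trans hd; apply: norm_le_coord => // j; rewrite !mxE eqxx /=.
  have [->|ji] := eqVneq j i; first by rewrite ltnn mulr1 addr0 (le_trans sh)// coord_norm_le.
  by rewrite mulr0 add0r; case: ifP => _; rewrite ?normr0// coord_norm_le.
have := K n (leqnn n).
rewrite (_ : trunc n h = h); last by apply/rowP => j; rewrite mxE ltn_ord.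
by rewrite (eq_bigl xpredT)// => j; rewrite ltn_ord.
Qed.

(** The candidate for the differential, D being the gradient. *)
Definition row_form (D : 'I_n -> R) h : R := \sum_i h 0 i * D i.

Fact row_form_linear D : linear (row_form D).
Proof.
move=> a u v; rewrite /row_form scaler_sumr -big_split/=; apply: eq_bigr => i _.
by rewrite !mxE mulrDl -mulrA.
Qed.

HB.instance Definition _ D :=
  GRing.isLinear.Build R 'rV[R]_n R *:%R (row_form D) (row_form_linear D).

Lemma row_form_continuous D : continuous (row_form D).
Proof.
move=> x; apply: (@cvg_sumr R _ _ (nbhs x) _) => i _.
by apply: cvgM; [exact: coord_continuous|exact: cvg_cst].
Qed.

Lemma differentiable_partials f x :
  (forall i, \forall y \near x, derivable f y (delta_mx 0 i)) ->
  (forall i, {for x, continuous ('D_(delta_mx 0 i) f)}) ->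
  differentiable f x.
Proof.
move=> df cf; pose D i := 'D_(delta_mx 0 i) f x.
pose df' : {linear 'rV[R]_n -> R} := row_form D.
apply: (@differentiable_increment R 'rV[R]_n R f df' x).
  by move=> y; exact: row_form_continuous.
move=> e e0.
(* n.+1 rather than n, so that the divisor is positive when n = 0 *)
pose e' := e / n.+1%:R; have e'0 : 0 < e' by rewrite divr_gt0.
have N : \forall y \near x, forall i, derivable f y (delta_mx 0 i) /\
    `|'D_(delta_mx 0 i) f y - D i| <= e'.
  have Ni (i : 'I_n) : \forall y \near x, derivable f y (delta_mx 0 i) /\
      `|'D_(delta_mx 0 i) f y - D i| <= e'.
    near=> y; split; first by near: y; exact: df.
    by rewrite distrC; near: y; exact: (@cvgr_dist_le _ _ _ (nbhs x) _ _ _ (cf i) e' e'0).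
  exact: (@filter_forall _ 'I_n _ (nbhs x) _ Ni).
have [d /= d0 Hd] := (nbhs_ballP _ _).1 N.
apply/nbhs_ballP; exists d => //= h; rewrite -ball_normE/= sub0r normrN => hd.
apply: (le_trans (@increment_bound f x h D e' d hd _)).
  move=> y i yd; apply: Hd; rewrite -ball_normE/= opprD addrCA subrr addr0.
  by rewrite normrN.
rewrite /e' mulrCA [leRHS]mulrC ler_wpM2l// mulrA ler_pdivrMr//.
by rewrite mulrC ler_wpM2l ?ler_nat// ltW.
Unshelve. all: by end_near. Qed.

End ContinuousPartials.

(** * Functions of class C^1 *)

Section C1Algebra.
Context {R : realType} {V : normedModType R} (U : set V) (U_open : open U).
Implicit Types f g : V -> R.

(** The way to establish C^1: exhibit the derivatives.  As U is open, d v and the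
    derivative agree near each point of U, which transfers continuity. *)
Lemma Ck1_is_derive f (d : V -> V -> R) :
  (forall x, U x -> {for x, continuous f}) ->
  (forall v x, U x -> is_derive x v f (d v x)) ->
  (forall v x, U x -> {for x, continuous (d v)}) -> Ck 1 U f.
Proof.
move=> cf df cd; split=> // v; split=> [x Ux|].
  by have [] := df v x Ux.
split=> // x Ux.
have E : \forall y \near x, d v y = 'D_v f y.
  near=> y; rewrite (@derive_val _ _ _ _ _ _ _ (df v y _))//.
  by near: y; exact: open_nbhs_nbhs.
rewrite /prop_for /continuous_at -(nbhs_singleton E).
by apply: cvg_trans (cd v x Ux); exact: near_eq_cvg.
Unshelve. all: by end_near. Qed.

Lemma Ck1_cts f x : Ck 1 U f -> U x -> {for x, continuous f}.
Proof. by move=> [H _]; exact: H. Qed.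

Lemma Ck1_derive f v x : Ck 1 U f -> U x -> is_derive x v f ('D_v f x).
Proof. by move=> [_ /(_ v)[H _]] Ux; split=> //; exact: H. Qed.

Lemma Ck1_derive_cts f v x : Ck 1 U f -> U x -> {for x, continuous ('D_v f)}.
Proof. by move=> [_ /(_ v)[_ [H _]]]; exact: H. Qed.

Lemma Ck1_cst (a : R) : Ck 1 U (fun=> a).
Proof.
apply: (@Ck1_is_derive _ (fun _ _ => 0)) => [x _|v x _].
  exact: cvg_cst.
exact: cvg_cst.
Qed.

Lemma Ck1D f g : Ck 1 U f -> Ck 1 U g -> Ck 1 U (fun x => f x + g x).
Proof.
move=> Cf Cg; apply: (@Ck1_is_derive _ (fun v x => 'D_v f x + 'D_v g x)).
- by move=> x Ux; apply: cvgD; exact: Ck1_cts.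
- by move=> v x Ux; apply: is_deriveD; exact: Ck1_derive.
- by move=> v x Ux; apply: cvgD; exact: Ck1_derive_cts.
Qed.

Lemma Ck1N f : Ck 1 U f -> Ck 1 U (fun x => - f x).
Proof.
move=> Cf; apply: (@Ck1_is_derive _ (fun v x => - 'D_v f x)).
- by move=> x Ux; apply: cvgN; exact: Ck1_cts.
- by move=> v x Ux; apply: is_deriveN; exact: Ck1_derive.
- by move=> v x Ux; apply: cvgN; exact: Ck1_derive_cts.
Qed.

Lemma Ck1M f g : Ck 1 U f -> Ck 1 U g -> Ck 1 U (fun x => f x * g x).
Proof.
move=> Cf Cg.
apply: (@Ck1_is_derive _ (fun v x => f x * 'D_v g x + g x * 'D_v f x)).
- by move=> x Ux; apply: cvgM; exact: Ck1_cts.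
- by move=> v x Ux; apply: is_deriveM; exact: Ck1_derive.
- move=> v x Ux; apply: cvgD; apply: cvgM;
    by [exact: Ck1_cts | exact: Ck1_derive_cts].
Qed.

Lemma Ck1V f : (forall x, U x -> f x != 0) -> Ck 1 U f ->
  Ck 1 U (fun x => (f x)^-1).
Proof.
move=> f0 Cf.
apply: (@Ck1_is_derive _ (fun v x => - (f x)^-2 * 'D_v f x)).
- by move=> x Ux; apply: cvgV; [exact: f0 | exact: Ck1_cts].
- move=> v x Ux; have [dfv _] := Ck1_derive v Cf Ux.
  by split; [exact: derivableV (f0 x Ux) dfv|exact: deriveV (f0 x Ux) dfv].
- move=> v x Ux; apply: cvgM; last exact: Ck1_derive_cts.
  apply: cvgN; apply: cvgV; first by rewrite expf_neq0// f0.
  by apply: cvgM; exact: Ck1_cts.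
Qed.

Lemma Ck1_sum (I : Type) (r : seq I) (P : pred I) (F : I -> V -> R) :
  (forall i, Ck 1 U (F i)) -> Ck 1 U (fun x => \sum_(i <- r | P i) F i x).
Proof.
move=> CF; elim: r => [|i r IH].
  rewrite (_ : (fun x => _) = fun=> 0); first exact: Ck1_cst.
  by apply/funext => x; rewrite big_nil.
have E : (fun x => \sum_(j <- i :: r | P j) F j x) =
    fun x => (if P i then F i x else 0) + \sum_(j <- r | P j) F j x.
  by apply/funext => x; rewrite big_cons; case: ifP => // _; rewrite add0r.
rewrite E; apply: Ck1D => //; case: (P i) => //; exact: Ck1_cst.
Qed.

Lemma Ck1_prod (I : Type) (r : seq I) (P : pred I) (F : I -> V -> R) :
  (forall i, Ck 1 U (F i)) -> Ck 1 U (fun x => \prod_(i <- r | P i) F i x).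
Proof.
move=> CF; elim: r => [|i r IH].
  rewrite (_ : (fun x => _) = fun=> 1); first exact: Ck1_cst.
  by apply/funext => x; rewrite big_nil.
have E : (fun x => \prod_(j <- i :: r | P j) F j x) =
    fun x => (if P i then F i x else 1) * \prod_(j <- r | P j) F j x.
  by apply/funext => x; rewrite big_cons; case: ifP => // _; rewrite mul1r.
rewrite E; apply: Ck1M => //; case: (P i) => //; exact: Ck1_cst.
Qed.

Lemma Ck1_det m (M : V -> 'M[R]_m) : (forall i j, Ck 1 U (fun x => M x i j)) ->
  Ck 1 U (fun x => \det (M x)).
Proof.
move=> CM; apply: Ck1_sum => s; apply: Ck1M; first exact: Ck1_cst.
by apply: Ck1_prod => i; exact: CM.
Qed.

Lemma Ck1_ext f g : (forall x, U x -> f x = g x) -> Ck 1 U f -> Ck 1 U g.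
Proof.
move=> fg Cf.
have N x : U x -> \near x, f x = g x.
  by move=> Ux; apply: filterS fg _; exact: open_nbhs_nbhs.
apply: (@Ck1_is_derive _ (fun v => 'D_v f)).
- move=> x Ux; rewrite /prop_for /continuous_at -fg//.
  by apply: cvg_trans (Ck1_cts Cf Ux); apply: near_eq_cvg; exact: N.
- move=> v x Ux; apply: near_eq_is_derive (Ck1_derive v Cf Ux); exact: N.
- by move=> v x Ux; exact: Ck1_derive_cts.
Qed.

(** Cramer's rule: the entries are quotients of determinants. *)
Lemma Ck1_invmx m (M : V -> 'M[R]_m) i j :
  (forall x, U x -> M x \in unitmx) ->
  (forall i j, Ck 1 U (fun x => M x i j)) -> Ck 1 U (fun x => invmx (M x) i j).
Proof.
move=> uM CM.
apply: (@Ck1_ext (fun x => (\det (M x))^-1 * cofactor (M x) j i)).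
  by move=> x Ux; rewrite /invmx uM// !mxE.
apply: Ck1M.
  apply: Ck1V; last exact: Ck1_det.
  by move=> x /uM; rewrite unitmxE unitfE.
apply: Ck1M; first exact: Ck1_cst.
apply: Ck1_det => a b.
rewrite (_ : (fun x => _) = fun x => M x (lift j a) (lift i b))//.
by apply/funext => x; rewrite !mxE.
Qed.

End C1Algebra.

Lemma Ck_sub (R : realType) (V : normedModType R) k (U W : set V) (f : V -> R) :
  U `<=` W -> Ck k W f -> Ck k U f.
Proof.
move=> UW; elim: k f => [|k IH] f [cf H]; split=> //; try by move=> x /UW; exact: cf.
move=> v; have [dv Cv] := H v; split; last exact: IH.
by move=> x /UW; exact: dv.
Qed.

Lemma Ck_open_ne0 (R : realType) (V : normedModType R) k (U : set V) (f : V -> R) :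
  open U -> Ck k U f -> open [set x | U x /\ f x != 0].
Proof.
move=> oU Cf; have {Cf} cf : forall x, U x -> {for x, continuous f}.
  by case: k Cf => [|k] [].
rewrite openE => x [Ux fx].
have N : \forall y \near x, f y != 0.
  by have := cf x Ux; move=> /cvgr_neq0; exact.
by apply: filterI N; exact: open_nbhs_nbhs.
Qed.

(** * Continuity of the curvature of a smooth family up to s = 0 *)

Section SmoothFamily.
Context {R : realType} {n : nat} (A : set 'rV[R]_n) (A_open : open A)
  (G : R -> 'rV[R]_n -> 'M[R]_n)
  (G_smooth : forall i j, smooth_on [set z : R * 'rV[R]_n | 0 <= z.1 /\ A z.2]
      (fun z => G z.1 z.2 i j))
  (x0 : 'rV[R]_n) (Ax0 : A x0) (G_unit : G 0 x0 \in unitmx).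

Let e (i : 'I_n) : R * 'rV[R]_n := (0, delta_mx 0 i).

Lemma derive_slice (f : R * 'rV[R]_n -> R) s x v :
  'D_v (fun y => f (s, y)) x = 'D_((0 : R), v) f (s, x).
Proof.
have E (h : R) : h *: ((0 : R), v) + (s, x) = (s, h *: v + x).
  by apply/eqP; rewrite xpair_eqE /= scaler0 add0r !eqxx.
by rewrite /derive /=; under [in RHS]eq_fun do rewrite E.
Qed.

(** For each s >= 0 the function [G s] coincides near x with a slice of functions
    F that are smooth on an open set around (0, x0), so its partial derivatives at
    x are derivatives of F at (s, x) in the directions (0, e_i).  The same argument
    applies once more to the Christoffel symbols, which by Cramer's rule are C^1
    where the determinant of F does not vanish. *)
Lemma riemann_extension l i j k : exists (W : set (R * 'rV[R]_n)) f,
  [/\ open W, W (0, x0), forall z, W z -> {for z, continuous f} &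
    forall s x, 0 <= s -> W (s, x) -> f (s, x) = riemann (G s) l i j k x].
Proof.
have /choice[F0 HF0] : forall ij : 'I_n * 'I_n,
    exists F : set (R * 'rV[R]_n) * (R * 'rV[R]_n -> R),
    [/\ open F.1, F.1 (0, x0), forall k, Ck k F.1 F.2 &
      forall y : R * 'rV[R]_n, 0 <= y.1 /\ A y.2 -> F.1 y ->
        F.2 y = G y.1 y.2 ij.1 ij.2].
  move=> [a b]; have [|U [F [oU U0 CF HF]]] := @G_smooth a b (0, x0); first by split.
  by exists (U, F).
pose F a b := (F0 (a, b)).2.
pose U1 := [set z : R * 'rV[R]_n | A z.2] `&`
   [set z | forall ij : 'I_n * 'I_n, (F0 ij).1 z].
have oU1 : open U1.
  apply: openI; first by apply: open_comp A_open => z _; exact: cvg_snd.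
  rewrite openE => z Uz.
  apply: (@filter_forall _ ('I_n * 'I_n)%type (fun ij => (F0 ij).1) (nbhs z)) => ij.
  by apply: open_nbhs_nbhs; split=> //; have [] := HF0 ij.
have CF1 m a b : Ck m U1 (F a b).
  have [_ _ H _] := HF0 (a, b); apply: Ck_sub (H m) => z [_]; exact.
have FG s x a b : 0 <= s -> U1 (s, x) -> F a b (s, x) = G s x a b.
  move=> s0 [Ax Ux]; have [_ _ _ H] := HF0 (a, b); exact: (H (s, x)).
pose M z : 'M[R]_n := \matrix_(a, b) F a b z.
have CM1 a b : Ck 1 U1 (fun z => M z a b).
  by rewrite (_ : (fun z => _) = F a b)//; apply/funext => z; rewrite mxE.
have MG s x : 0 <= s -> U1 (s, x) -> M (s, x) = G s x.
  by move=> s0 Ux; apply/matrixP => a b; rewrite mxE FG.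
pose W := [set z | U1 z /\ \det (M z) != 0].
have oW : open W by apply: (@Ck_open_ne0 _ _ 1) => //; exact: Ck1_det.
have WU z : W z -> U1 z by case.
have U10 : U1 (0, x0) by split=> //= ij; have [] := HF0 ij.
have W0 : W (0, x0) by split=> //; rewrite MG// -unitfE -unitmxE.
have CF m a b : Ck m W (F a b) by apply: Ck_sub (CF1 m a b).
have CD a b v : Ck 1 W ('D_v (F a b)) by have [_ /(_ v)[]] := CF 2%N a b.
pose Gam k i j z := 2^-1 * \sum_l invmx (M z) k l *
    ('D_(e i) (F j l) z + 'D_(e j) (F i l) z - 'D_(e l) (F i j) z).
have CGam a b c : Ck 1 W (Gam a b c).
  apply: Ck1M => //; first exact: Ck1_cst.
  apply: Ck1_sum => // m; apply: Ck1M => //.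
    apply: Ck1_invmx => //; first by move=> z [_]; rewrite unitmxE unitfE.
    by move=> a' b'; exact: Ck_sub (CM1 a' b').
  by apply: Ck1D => //; [exact: Ck1D | exact: Ck1N].
have nearW s x : W (s, x) -> \forall y \near x, W (s, y).
  move=> Wx; have : \forall z \near (s, x), W z by exact: open_nbhs_nbhs.
  have cs : {for x, continuous (fun y : 'rV[R]_n => (s, y))}.
    exact: (@cvg_pair _ _ _ (nbhs x) (nbhs s) (nbhs x) _ _ _ (fun=> s) id
      (cvg_cst s) cvg_id).
  exact: cs.
have Gpartial s x a b c : 0 <= s -> W (s, x) ->
    partial a (fun y => G s y b c) x = 'D_(e a) (F b c) (s, x).
  move=> s0 Wx; rewrite /partial -derive_slice; apply: near_eq_derive.
  by apply: filterS (nearW s x Wx) => y Wy; rewrite FG//; exact: WU.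
have GamE s x a b c : 0 <= s -> W (s, x) ->
    christoffel (G s) a b c x = Gam a b c (s, x).
  move=> s0 Wx; rewrite /christoffel /Gam; congr (_ * _); apply: eq_bigr => m _.
  by rewrite !Gpartial// MG//; exact: WU.
have Gam_partial s x a b c d : 0 <= s -> W (s, x) ->
    partial a (christoffel (G s) b c d) x = 'D_(e a) (Gam b c d) (s, x).
  move=> s0 Wx; rewrite /partial -derive_slice; apply: near_eq_derive.
  by apply: filterS (nearW s x Wx) => y Wy; exact: GamE.
exists W, (fun z => 'D_(e i) (Gam l j k) z - 'D_(e j) (Gam l i k) z
  + \sum_m (Gam m j k z * Gam l i m z - Gam m i k z * Gam l j m z)).
split=> // [z Wz|s x s0 Wx].
  have cG a b c : {for z, continuous (Gam a b c)} by exact: Ck1_cts.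
  have cDG a b c v : {for z, continuous ('D_v (Gam a b c))} by exact: Ck1_derive_cts.
  apply: cvgD; first by apply: cvgB; exact: cDG.
  apply: (@cvg_sumr R _ _ (nbhs z) _) => m _.
  by apply: cvgB; apply: cvgM; exact: cG.
rewrite /riemann !Gam_partial//; congr (_ + _); apply: eq_bigr => m _.
by rewrite !GamE.
Qed.

Lemma cvg_riemann l i j k :
  riemann (G z.1) l i j k z.2 @[z --> within [set z : R * 'rV[R]_n | 0 <= z.1]
      (nbhs ((0 : R), x0))]
    --> riemann (G 0) l i j k x0.
Proof.
have [W [f [oW W0 cf Wf]]] := riemann_extension l i j k.
have N : \forall z \near within [set z : R * 'rV[R]_n | 0 <= z.1] (nbhs ((0 : R), x0)),
    f z = riemann (G z.1) l i j k z.2.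
  rewrite near_withinE; have : \forall z \near ((0 : R), x0), W z.
    exact: open_nbhs_nbhs.
  by apply: filterS => -[s x] /= Wx s0; rewrite Wf.
rewrite -Wf//; apply: cvg_trans (near_eq_cvg N) _.
exact: (@cvg_within_filter _ _ f _ _ _ _ (cf _ W0)).
Qed.

End SmoothFamily.

(** * Components perpendicular to a subspace *)

Section InnerProduct.
Context {R : realType} {V : vectType R} (ip : V -> V -> R).
Context (ip_linear : forall (a : R) (u v w : V),
  ip (a *: u + v) w = a * ip u w + ip v w).
Context (ip_sym : forall u v : V, ip u v = ip v u).
Context (ip_pos : forall u : V, u != 0 -> 0 < ip u u).

Lemma ip0l w : ip 0 w = 0.
Proof.
have := ip_linear 0 0 0 w; rewrite scale0r addr0 mul0r add0r => _.
have := ip_linear 1 0 0 w; rewrite scaler0 addr0 mul1r => h.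
by apply: (@addrI _ (ip 0 w)); rewrite -h addr0.
Qed.

Lemma ipDl u v w : ip (u + v) w = ip u w + ip v w.
Proof. by have := ip_linear 1 u v w; rewrite scale1r mul1r. Qed.

Lemma ipZl a u w : ip (a *: u) w = a * ip u w.
Proof. by have := ip_linear a u 0 w; rewrite addr0 ip0l addr0. Qed.

Lemma ipDr u v w : ip w (u + v) = ip w u + ip w v.
Proof. by rewrite !(ip_sym w) ipDl. Qed.

Lemma ipZr a u w : ip w (a *: u) = a * ip w u.
Proof. by rewrite !(ip_sym w) ipZl. Qed.

Lemma ipNl u w : ip (- u) w = - ip u w.
Proof. by rewrite -scaleN1r ipZl mulN1r. Qed.

Lemma ipBl u v w : ip (u - v) w = ip u w - ip v w.
Proof. by rewrite ipDl ipNl. Qed.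

Lemma ipBr u v w : ip w (u - v) = ip w u - ip w v.
Proof. by rewrite !(ip_sym w) ipBl. Qed.

Lemma ip_suml (I : Type) (r : seq I) (P : pred I) (F : I -> V) w :
  ip (\sum_(i <- r | P i) F i) w = \sum_(i <- r | P i) ip (F i) w.
Proof. by elim/big_rec2: _ => [|i a b _ <-]; rewrite ?ip0l ?ipDl. Qed.

Lemma ip_sumr (I : Type) (r : seq I) (P : pred I) (F : I -> V) w :
  ip w (\sum_(i <- r | P i) F i) = \sum_(i <- r | P i) ip w (F i).
Proof. by rewrite ip_sym ip_suml; apply: eq_bigr => i _; rewrite ip_sym. Qed.

Lemma ip_ge0 u : 0 <= ip u u.
Proof. by have [->|/ip_pos/ltW//] := eqVneq u 0; rewrite ip0l. Qed.

Lemma ip_eq0 u : ip u u = 0 -> u = 0.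
Proof.
by move=> h; apply/eqP; apply: contraT => /ip_pos; rewrite h ltxx.
Qed.

Lemma ip_cauchy_schwarz u v : ip u v ^+ 2 <= ip u u * ip v v.
Proof.
have [->|v0] := eqVneq v 0; first by rewrite ip_sym !ip0l expr0n mulr0.
have vv := ip_pos v0; have := ip_ge0 (ip v v *: u - ip u v *: v).
rewrite !(ipBl, ipBr, ipZl, ipZr) (ip_sym v u).
move=> h; rewrite -(ler_pM2l vv) -subr_ge0; move: h; congr (0 <= _); ring.
Qed.

(** A row vector a killed by the Gram matrix gives a combination of the X i that
    is orthogonal to all of them, hence to itself. *)
Lemma free_gram_unit k (X : 'I_k -> V) :
  (forall a : 'I_k -> R, \sum_i a i *: X i = 0 -> forall i, a i = 0) ->
  \matrix_(i, j) ip (X i) (X j) \in unitmx.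
Proof.
move=> freeX; set G := \matrix_(i, j) _.
rewrite -row_free_unit -kermx_eq0; apply/eqP/row_matrixP => i; rewrite row0.
have : row i (kermx G) *m G = 0 by rewrite -row_mul mulmx_ker row0.
move: (row i _) => a aG.
apply/rowP => j; rewrite [RHS]mxE.
apply: (freeX (fun j => a 0 j)); apply: ip_eq0.
rewrite ip_sumr big1// => m _; rewrite ipZr ip_suml.
suff -> : \sum_j ip (a 0 j *: X j) (X m) = (a *m G) 0 m.
  by rewrite aG mxE mulr0.
by rewrite [RHS]mxE; apply: eq_bigr => t _; rewrite ipZl [G _ _]mxE.
Qed.

Lemma vbasis_gram_unit (W : {vspace V}) :
  \matrix_(i < \dim W, j < \dim W) ip (vbasis W)`_i (vbasis W)`_j \in unitmx.
Proof.
apply: free_gram_unit => a.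
have /freeP := basis_free (vbasisP W); apply.
Qed.

(** The dual basis, obtained from the inverse Gram matrix.  The second property
    says that the sum is the orthogonal projection of u to W; it yields
    perpendicular components, and bounded coordinate functions. *)
Lemma dual_basis (W : {vspace V}) : exists b : 'I_(\dim W) -> V,
  (forall i, b i \in W) /\
  forall u w, w \in W -> ip (\sum_i ip u (b i) *: (vbasis W)`_i) w = ip u w.
Proof.
set X := fun i : 'I_(\dim W) => (vbasis W)`_i.
set G := \matrix_(i < \dim W, j < \dim W) ip (X i) (X j).
have GU : G \in unitmx := vbasis_gram_unit W.
have XW i : X i \in W by apply: vbasis_mem; rewrite mem_nth// size_tuple.
exists (fun i => \sum_j invmx G j i *: X j); split=> [i|u w wW].
  by apply: rpred_sum => j _; apply: rpredZ.
have XE m : ip (\sum_i ip u (\sum_j invmx G j i *: X j) *: X i) (X m) = ip u (X m).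
  rewrite ip_suml; pose r := \row_j ip u (X j).
  transitivity ((r *m invmx G *m G) 0 m); last by rewrite mulmxKV// mxE.
  rewrite mxE; apply: eq_bigr => i _; rewrite ipZl !mxE; congr (_ * _).
  by rewrite ip_sumr; apply: eq_bigr => j _; rewrite ipZr !mxE mulrC.
rewrite (coord_vbasis wW) !ip_sumr; apply: eq_bigr => m _.
by rewrite !ipZr XE.
Qed.

Lemma perp_ex (W : {vspace V}) u :
  exists y, u - y \in W /\ forall w, w \in W -> ip w y = 0.
Proof.
have [b [bW bE]] := dual_basis W.
exists (u - \sum_i ip u (b i) *: (vbasis W)`_i); split.
  rewrite opprB addrCA subrr addr0; apply: rpred_sum => i _; apply: rpredZ.
  by apply: vbasis_mem; rewrite mem_nth// size_tuple.
by move=> w wW; rewrite ip_sym ipBl bE// subrr.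
Qed.

Lemma perp_partP (W : {vspace V}) u :
  u - perp_part ip W u \in W /\ forall w, w \in W -> ip w (perp_part ip W u) = 0.
Proof. exact: xgetPex (perp_ex W u). Qed.

Lemma perp_part_eq0 (W : {vspace V}) u : perp_part ip W u = 0 <-> u \in W.
Proof.
have [uy yW] := perp_partP W u; split=> [y0|uW]; first by rewrite y0 subr0 in uy.
apply: ip_eq0; apply: yW; have := rpredB uW uy.
by rewrite opprB addrCA subrr addr0.
Qed.

Lemma perp_part_le (W : {vspace V}) u :
  ip (perp_part ip W u) (perp_part ip W u) <= ip u u.
Proof.
have [uy yW] := perp_partP W u; set y := perp_part ip W u in uy yW *.
have -> : ip u u = ip (u - y + y) (u - y + y) by rewrite subrK.
move: (u - y) uy => z uy; rewrite ipDl !ipDr (yW _ uy) (ip_sym y) (yW _ uy) addr0 add0r.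
by rewrite lerDr ip_ge0.
Qed.

(** By the Cauchy-Schwarz inequality, the coordinates of a unit vector are at most
    the norms of the dual basis vectors. *)
Lemma unit_sphere_bounded (W : {vspace V}) (Phi : V -> V) : linear Phi ->
  exists C, forall w, w \in W -> ip w w = 1 -> ip (Phi w) (Phi w) <= C.
Proof.
move=> linP; pose L := GRing.isLinear.Build R V V *:%R Phi linP.
pose Ph : {linear V -> V} := HB.pack Phi L.
have [b [bW bE]] := dual_basis W; pose X i := (vbasis W)`_i.
pose N u := Num.sqrt (ip u u).
exists (\sum_(i < \dim W) \sum_(j < \dim W)
  N (b i) * (N (b j) * `|ip (Phi (X i)) (Phi (X j))|)).
move=> w wW w1.
have wE : w = \sum_i ip w (b i) *: X i.
  have sW : \sum_i ip w (b i) *: X i \in W.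
    apply: rpred_sum => i _; apply: rpredZ.
    by apply: vbasis_mem; rewrite mem_nth// size_tuple.
  apply/eqP; rewrite eq_sym -subr_eq0; apply/eqP; apply: ip_eq0.
  by rewrite ipBl bE ?subrr// rpredB.
have wb i : `|ip w (b i)| <= N (b i).
  by rewrite -sqrtr_sqr ler_wsqrtr// (le_trans (ip_cauchy_schwarz _ _))// w1 mul1r.
have -> : Phi w = \sum_i ip w (b i) *: Phi (X i).
  rewrite {1}wE [LHS](linear_sum Ph); apply: eq_bigr => i _.
  exact: (linearZ_LR Ph).
rewrite ip_suml ler_sum// => i _; rewrite ipZl ip_sumr mulr_sumr ler_sum// => j _.
rewrite ipZr (le_trans (ler_norm _))// !normrM ler_pM//.
by rewrite ler_pM.
Qed.

(** The values whose supremum is calI are nonnegative and bounded, so all of them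
    vanish when calI does.  The bound matters, as the supremum of an unbounded
    set is 0 by convention. *)
Lemma calI_eq0 (W : {vspace V}) (Phi : V -> V) : linear Phi ->
  calI ip Phi W = 0 <-> forall w, w \in W -> Phi w \in W.
Proof.
move=> linP.
pose Ph : {linear V -> V} := HB.pack Phi (GRing.isLinear.Build R V V *:%R Phi linP).
rewrite /calI; set S := [set _ | w in _]; split=> [S0 w wW|inv]; last first.
  have S1 : S `<=` [set 0].
    move=> _ [w [wW w1] <-] /=; have /perp_part_eq0 -> := inv w wW.
    by rewrite ip0l sqrtr0.
  have [->|/set0P[x Sx]] := eqVneq S set0; first by rewrite sup0.
  rewrite (_ : S = [set 0]) ?sup1//; apply/seteqP; split=> // _ ->.
  by rewrite -(S1 x Sx).
have [->|w0] := eqVneq w 0; first by rewrite [Phi 0](linear0 Ph) mem0v.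
have ww := ip_pos w0; pose a := (Num.sqrt (ip w w))^-1.
have a0 : a != 0 by rewrite invr_eq0 gt_eqF// sqrtr_gt0.
have aw : a *: w \in W by apply: rpredZ.
have aw1 : ip (a *: w) (a *: w) = 1.
  rewrite ipZl ipZr mulrA -expr2 /a exprVn sqr_sqrtr ?ltW// mulVf//.
  by rewrite gt_eqF.
suff : Phi (a *: w) \in W.
  rewrite [Phi _](linearZ_LR Ph) => h.
  by rewrite -[Phi w](scalerK a0) rpredZ.
apply/perp_part_eq0/ip_eq0; set y := perp_part _ _ _.
have [C HC] := unit_sphere_bounded W linP.
have Sy : S (Num.sqrt (ip y y)) by exists (a *: w).
have hS : has_sup S.
  split; first by exists (Num.sqrt (ip y y)).
  exists (Num.sqrt C) => _ [v [vW v1] <-]; apply: ler_wsqrtr.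
  by apply: le_trans (HC v vW v1); exact: perp_part_le.
have := sup_upper_bound hS Sy; rewrite S0 => h.
by apply/eqP; rewrite eq_le ip_ge0 andbT -sqrtr_eq0 eq_le h sqrtr_ge0.
Qed.

End InnerProduct.

(** * Changes of chart *)

Lemma smooth_on_differentiable (R : realType) (n : nat) (A : set 'rV[R]_n)
    (f : 'rV[R]_n -> R) x :
  open A -> smooth_on A f -> A x -> differentiable f x.
Proof.
move=> oA sf Ax; have [U [F [oU Ux CF Ff]]] := sf x Ax.
have oUA : open (U `&` A) by exact: openI.
have Cf : Ck 1 (U `&` A) f.
  apply: (Ck1_ext oUA _ (Ck_sub (@subIsetl _ U A) (CF 1%N))) => y [Uy Ay].
  exact: Ff.
have UAx : (U `&` A) x by [].
apply: differentiable_partials => i; last exact: Ck1_derive_cts Cf UAx.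
have : \forall y \near x, (U `&` A) y by exact: open_nbhs_nbhs.
by apply: filterS => y Uy; have [] := Ck1_derive (delta_mx 0 i) Cf Uy.
Qed.

Lemma differentiable_row (R : realType) (V : normedModType R) (n : nat)
    (f : V -> 'rV[R]_n) x :
  (forall i, differentiable (fun y => f y 0 i) x) -> differentiable f x.
Proof.
move=> df.
have -> : f = \sum_(i < n) (fun y => f y 0 i *: (delta_mx 0 i : 'rV[R]_n)).
  by apply/funext => y; rewrite fct_sumE [LHS]row_sum_delta.
apply: differentiable_sum => i; apply: differentiableZl; exact: df.
Qed.

Section Transitions.
Context {R : realType} {n : nat} {M : manifold R n}.
Implicit Types (c d : chart R n M) (p : M) (g : metric M).

Lemma overlap_open c d :
  open [set x | chart_codom c x /\ chart_dom d (chart_inv c x)].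
Proof.
rewrite openE => x [cx dx]; apply: filterI.
  by apply: open_nbhs_nbhs; split=> //; exact: chart_codom_open.
apply: (chart_inv_cts cx); apply: open_nbhs_nbhs; split=> //.
exact: chart_dom_open.
Qed.

Lemma transition_differentiable c d p : atlas c -> atlas d ->
  chart_dom c p -> chart_dom d p -> differentiable (transition c d) (c p).
Proof.
move=> ac ad cp dp; apply: differentiable_row => i.
apply: (smooth_on_differentiable (@overlap_open c d) (atlas_smooth ac ad i)).
by split; [exact: chart_funP|rewrite chart_funK].
Qed.

(** The chain rule for the identity, which near c p is a composite of the two
    transition maps. *)
Lemma jacobian_transitionK c d p : atlas c -> atlas d ->
  chart_dom c p -> chart_dom d p ->
  'J (transition c d) (c p) *m 'J (transition d c) (d p) = 1%:M.
Proof.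
move=> ac ad cp dp.
have dcd := transition_differentiable ac ad cp dp.
have ddc := transition_differentiable ad ac dp cp.
have Tp : transition c d (c p) = d p by rewrite /transition chart_funK.
rewrite -Tp in ddc.
apply/row_matrixP => i; rewrite row_mul row1 rowE.
rewrite -Tp /jacobian !mul_rV_lin1.
have := diff_comp dcd ddc => /(congr1 (fun h => h (delta_mx 0 i))) /= <-.
rewrite -deriveE; last exact: differentiable_comp.
rewrite -[RHS](@derive_id _ _ (c p)); apply: near_eq_derive.
have : \forall x \near c p, chart_codom c x /\ chart_dom d (chart_inv c x).
  apply: open_nbhs_nbhs; split; first exact: overlap_open.
  by split; [exact: chart_funP|rewrite chart_funK].
apply: filterS => x [cx dx] /=.
by rewrite /transition chart_funK// chart_invK.
Qed.

Lemma chart_atP p : atlas (chart_at p) /\ chart_dom (chart_at p) p.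
Proof. by rewrite /chart_at; case: cid2. Qed.

(** The inverse of [tcoord c]. *)
Definition tvec c p (u : 'rV[R]_n) : tangent p :=
  u *m 'J (transition c (chart_at p)) (c p).

Lemma tcoordK c p : atlas c -> chart_dom c p -> cancel (@tcoord R n M c p) (@tvec c p).
Proof.
move=> ac cp v; have [aa ap] := chart_atP p.
by rewrite /tcoord /tvec -mulmxA jacobian_transitionK// mulmx1.
Qed.

Lemma tvecK c p : atlas c -> chart_dom c p -> cancel (@tvec c p) (@tcoord R n M c p).
Proof.
move=> ac cp v; have [aa ap] := chart_atP p.
by rewrite /tcoord /tvec -mulmxA jacobian_transitionK// mulmx1.
Qed.

Lemma tcoord_linear c p : linear (@tcoord R n M c p).
Proof. by move=> a u v; rewrite /tcoord mulmxDl -scalemxAl. Qed.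

(** The coordinate vector fields of c are a basis, because their coordinates in c
    are the unit vectors. *)
Lemma gram_unit g c x : atlas c -> chart_codom c x -> gram g c x \in unitmx.
Proof.
move=> ac cx; have cp := chart_invP cx.
apply: (free_gram_unit (@inner_linear _ _ _ g _) (@inner_sym _ _ _ g _)
  (@inner_pos _ _ _ g _)) => a h i.
suff : \row_i a i = 0 by move=> /rowP/(_ i); rewrite !mxE.
have E : \sum_j a j *: tbasis c (chart_inv c x) j = tvec c (chart_inv c x) (\row_i a i).
  by rewrite /tvec mulmx_sum_row; apply: eq_bigr => j _; rewrite mxE.
rewrite -(tvecK ac cp (\row_i a i)) -E h /tcoord.
exact: mul0mx.
Qed.

End Transitions.

(** * Row-free matrices and entrywise limits *)

Section RowFree.
Context {R : realType}.

(** Turns a rank condition into the nonvanishing of a continuous function. *)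
Lemma row_free_gram k n (N : 'M[R]_(k, n)) :
  row_free N = (\det (N *m N^T) != 0).
Proof.
rewrite -unitfE -unitmxE; apply/idP/idP => [fN|uN]; last first.
  by apply/row_freeP; exists (N^T *m invmx (N *m N^T)); rewrite mulmxA mulmxV.
pose ip (u v : 'rV[R]_n) : R := (u *m v^T) 0 0.
have -> : N *m N^T = \matrix_(i, j) ip (row i N) (row j N).
  by apply/matrixP => i j; rewrite [RHS]mxE /ip [LHS]mxE [RHS]mxE;
    apply: eq_bigr => m _; rewrite !mxE.
apply: free_gram_unit.
- by move=> a u v w; rewrite /ip mulmxDl -scalemxAl !mxE.
- by move=> u v; rewrite /ip -[v *m _]trmxK trmx_mul trmxK [RHS]mxE.
- move=> u u0; have [j uj] : exists j, u 0 j != 0.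
    apply/existsP; apply: contraNT u0; rewrite negb_exists => /forallP h.
    by apply/eqP/rowP => j; rewrite mxE; apply/eqP; have := h j; rewrite negbK.
  rewrite /ip mxE (bigD1 j)//= mxE ltr_wpDr//.
    by apply: sumr_ge0 => m _; rewrite mxE -expr2 sqr_ge0.
  by rewrite -expr2 lt_def sqr_ge0 sqrf_eq0 uj.
- move=> a h i; have : \row_j a j *m N = 0.
    by rewrite mulmx_sum_row -[RHS]h; apply: eq_bigr => j _; rewrite mxE.
  move/eqP; rewrite mulmx_free_eq0// => /eqP/rowP/(_ i).
  by rewrite !mxE.
Qed.

Lemma row_free_col_mx k n (A : 'M[R]_(k, n)) (y : 'rV[R]_n) :
  row_free A -> row_free (col_mx A y) = ~~ (y <= A)%MS.
Proof.
move=> fA; apply/idP/idP => [fN|yA].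
  apply/negP => /submxP[D yE].
  have : row_mx (- D) 1%:M *m col_mx A y = 0.
    by rewrite mul_row_col mul1mx mulNmx yE addNr.
  move/eqP; rewrite mulmx_free_eq0// => /eqP/(congr1 rsubmx).
  rewrite row_mxKr => /matrixP/(_ 0 0); rewrite !mxE => /eqP.
  by rewrite oner_eq0.
rewrite /row_free eqn_leq rank_leq_row -addsmxE addn1 /=.
apply: leq_ltn_trans (_ : \rank A < _)%N; first by rewrite (eqP fA).
by apply: rank_ltmx; rewrite ltmxE addsmxSl addsmx_sub submx_refl.
Qed.

End RowFree.

Section EntrywiseLimits.
Context {R : realType} {T : Type} (F : set_system T) {FF : Filter F}.

Definition mx_cvg m n (f : T -> 'M[R]_(m, n)) (L : 'M[R]_(m, n)) : Prop :=
  forall i j, f t i j @[t --> F] --> L i j.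

Lemma mx_cvg_cst m n (L : 'M[R]_(m, n)) : mx_cvg (fun=> L) L.
Proof. by move=> i j; exact: cvg_cst. Qed.

Lemma mx_cvg_mul m n p (f : T -> 'M[R]_(m, n)) (g : T -> 'M[R]_(n, p)) A B :
  mx_cvg f A -> mx_cvg g B -> mx_cvg (fun t => f t *m g t) (A *m B).
Proof.
move=> fA gB i j; rewrite mxE.
rewrite (_ : (fun t => _) = fun t => \sum_l f t i l * g t l j); last first.
  by apply/funext => t; rewrite mxE.
by apply: cvg_sumr => l _; apply: cvgM.
Qed.

Lemma mx_cvg_tr m n (f : T -> 'M[R]_(m, n)) A :
  mx_cvg f A -> mx_cvg (fun t => (f t)^T) A^T.
Proof.
move=> fA i j; rewrite mxE.
by rewrite (_ : (fun t => _) = fun t => f t j i)//; apply/funext => t; rewrite mxE.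
Qed.

Lemma mx_cvg_col m1 m2 n (f : T -> 'M[R]_(m1, n)) (g : T -> 'M[R]_(m2, n)) A B :
  mx_cvg f A -> mx_cvg g B -> mx_cvg (fun t => col_mx (f t) (g t)) (col_mx A B).
Proof.
move=> fA gB i j; rewrite mxE.
rewrite (_ : (fun t => _) = fun t => match fintype.split i with
    | inl i1 => f t i1 j | inr i2 => g t i2 j end).
  by case: (fintype.split i).
by apply/funext => t; rewrite mxE.
Qed.

Lemma mx_cvg_det n (f : T -> 'M[R]_n) A :
  mx_cvg f A -> \det (f t) @[t --> F] --> \det A.
Proof.
move=> fA; apply: cvg_sumr => s _; apply: cvgM; first exact: cvg_cst.
by apply: cvg_prodr => i _.
Qed.

End EntrywiseLimits.

(** * Partially geodesic planes in coordinates *)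

Section Components.
Context {R : realType} {n : nat}.

(** R(u, v) w in coordinates, G being the matrix of the metric. *)
Definition curv_form (G : 'rV[R]_n -> 'M[R]_n) (x u v w : 'rV[R]_n) : 'rV[R]_n :=
  \sum_i \sum_j \sum_k (u 0 i * v 0 j * w 0 k) *: \row_l riemann G l i j k x.

Lemma curv_form_linear G x v w : linear (fun u => curv_form G x u v w).
Proof.
move=> a u u'; rewrite /curv_form.
do 3 (rewrite scaler_sumr -big_split /=; apply: eq_bigr => ? _).
by rewrite !mxE scalerA -scalerDl; congr (_ *: _); ring.
Qed.

Lemma mx_cvg_curv_form (T : Type) (F : set_system T) (FF : Filter F)
    (G : T -> 'rV[R]_n -> 'M[R]_n) (x u v w : T -> 'rV[R]_n) G0 x0 u0 v0 w0 :
  (forall l i j k, riemann (G t) l i j k (x t) @[t --> F] --> riemann G0 l i j k x0) ->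
  mx_cvg F u u0 -> mx_cvg F v v0 -> mx_cvg F w w0 ->
  mx_cvg F (fun t => curv_form (G t) (x t) (u t) (v t) (w t))
    (curv_form G0 x0 u0 v0 w0).
Proof.
move=> HG Hu Hv Hw a l; rewrite (ord1 a).
have E G' x' u' v' w' : curv_form G' x' u' v' w' 0 l =
   \sum_i \sum_j \sum_k u' 0 i * v' 0 j * w' 0 k * riemann G' l i j k x'.
  rewrite /curv_form summxE; apply: eq_bigr => i _; rewrite summxE.
  apply: eq_bigr => j _; rewrite summxE; apply: eq_bigr => k _.
  by rewrite !mxE.
rewrite E (_ : (fun t => _) = fun t => \sum_i \sum_j \sum_k
   u t 0 i * v t 0 j * w t 0 k * riemann (G t) l i j k (x t)); last first.
  by apply/funext => t; rewrite E.
do 3 (apply: cvg_sumr => ? _).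
by apply: cvgM => //; apply: cvgM => //; apply: cvgM.
Qed.

End Components.

Section Frames.
Context {R : realType} {n : nat} {M : manifold R n} {k : nat}.
Implicit Types (c : chart R n M) (P Q : plane M k) (A : 'M[R]_(k, n)).

Let tcoord_sum c p (a : 'I_k -> R) (X : 'I_k -> tangent p) :
  tcoord c (\sum_i a i *: X i) = \sum_i a i *: tcoord c (X i).
Proof.
rewrite /tcoord mulmx_suml; apply: eq_bigr => i _; exact: (esym (scalemxAl _ _ _)).
Qed.

Lemma frame_sum c P A (b : k.-tuple (tangent (foot P))) (a : 'I_k -> R) :
  (forall i, row i A = tcoord c (tnth b i)) ->
  tcoord c (\sum_(i < k) a i *: b`_i) = \row_i a i *m A.
Proof.
move=> bA; rewrite mulmx_sum_row (tcoord_sum c a (fun i => b`_i)).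
by apply: eq_bigr => i _; rewrite mxE bA (tnth_nth 0).
Qed.

Lemma mem_frame c P A : atlas c -> chart_dom c (foot P) -> frame c P A ->
  forall v, (v \in plane_space P) = (tcoord c v <= A)%MS.
Proof.
move=> ac cP [b bP bA] v; apply/idP/submxP => [vP|[D vE]].
  exists (\row_i coord b i v); rewrite -(frame_sum _ bA).
  by rewrite -(coord_basis bP vP).
rewrite -[v](tcoordK ac cP) vE.
have -> : D = \row_i D 0 i by apply/rowP => i; rewrite mxE.
rewrite -(frame_sum _ bA) tcoordK//.
apply: rpred_sum => i _; apply: rpredZ.
by apply: (basis_mem bP); rewrite mem_nth// size_tuple.
Qed.

Lemma frame_row_free c P A : atlas c -> chart_dom c (foot P) -> frame c P A ->
  row_free A.
Proof.
move=> ac cP [b bP bA]; rewrite -kermx_eq0; apply/eqP/row_matrixP => i.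
have : row i (kermx A) *m A = 0 by rewrite -row_mul mulmx_ker row0.
rewrite row0; move: (row i _) => D.
have -> : D = \row_i D 0 i by apply/rowP => j; rewrite mxE.
rewrite -(frame_sum _ bA) => /(congr1 (@tvec _ _ _ c (foot P))).
rewrite tcoordK// [RHS]mul0mx => h0.
have /freeP/(_ _ h0) h := basis_free bP.
by apply/rowP => j; rewrite !mxE h.
Qed.

Lemma frameI c P A : atlas c -> chart_dom c (foot P) -> row_free A ->
  (forall v, (v \in plane_space P) = (tcoord c v <= A)%MS) -> frame c P A.
Proof.
move=> ac cP fA AP.
pose b := [tuple tvec c (foot P) (row i A) | i < k].
have bA i : row i A = tcoord c (tnth b i) by rewrite tnth_mktuple tvecK.
exists b => //; rewrite basisEfree dim_plane size_tuple leqnn andbT.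
apply/andP; split.
  apply/freeP => a /(congr1 (@tcoord _ _ _ c (foot P))).
  rewrite (frame_sum _ bA) [RHS]mul0mx => /eqP.
  by rewrite mulmx_free_eq0// => /eqP/rowP + i => /(_ i); rewrite !mxE.
apply/span_subvP => v /tnthP[i ->].
by rewrite AP -bA row_sub.
Qed.

Lemma plane_of_frame c p A : atlas c -> chart_dom c p -> row_free A ->
  exists2 P : plane M k, foot P = p & frame c P A.
Proof.
move=> ac cp fA; pose b := [tuple tvec c p (row i A) | i < k].
have bA i : row i A = tcoord c (tnth b i) by rewrite tnth_mktuple tvecK.
have freeb : free b.
  apply/freeP => a /(congr1 (@tcoord _ _ _ c p)).
  rewrite (tcoord_sum c a (fun i => b`_i)) [RHS]mul0mx => h i.
  have : \row_i a i *m A = 0.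
    by rewrite mulmx_sum_row -[RHS]h; apply: eq_bigr => j _; rewrite mxE bA (tnth_nth 0).
  by move/eqP; rewrite mulmx_free_eq0// => /eqP/rowP/(_ i); rewrite !mxE.
have dimb : \dim <<b>> = k by rewrite (eqP freeb) size_tuple.
exists (Plane dimb) => //=; exists b => //=.
by rewrite /basis_of eqxx.
Qed.

Lemma frame_of_plane c P : atlas c -> chart_dom c (foot P) ->
  exists A, frame c P A.
Proof.
move=> ac cP; have := vbasisP (plane_space P).
move: (vbasis _); rewrite dim_plane => b bP.
exists (\matrix_i tcoord c (tnth b i)), b => // i.
by rewrite rowK.
Qed.

Lemma frame_mul c P A (B : 'M[R]_k) : atlas c -> chart_dom c (foot P) ->
  B \in unitmx -> frame c P A -> frame c P (B *m A).
Proof.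
move=> ac cP uB fA.
have E : (B *m A :=: A)%MS by apply: eqmxMfull; rewrite row_full_unit.
apply: frameI => //.
  by rewrite /row_free E; exact: frame_row_free fA.
by move=> v; rewrite E; exact: mem_frame.
Qed.

(** [calI_eq0] for the Jacobi operators, read in the coordinates of c. *)
Lemma partially_geodesicP (g : metric M) (Rm : tensor13 M) c P A :
  curvature_tensor g Rm -> atlas c -> chart_dom c (foot P) -> frame c P A ->
  partially_geodesic g Rm P <->
  forall v w : 'rV[R]_n, (v <= A)%MS -> (w <= A)%MS ->
    (curv_form (gram g c) (c (foot P)) w v v <= A)%MS.
Proof.
move=> RmC ac cP fA; have mA := mem_frame ac cP fA.
have RmE u v w : tcoord c (Rm (foot P) u v w) = curv_form (gram g c)
    (c (foot P)) (tcoord c u) (tcoord c v) (tcoord c w) by exact: RmC.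
have linJ (v : tangent (foot P)) : linear (jacobi Rm v).
  move=> a u u'; apply: (can_inj (tcoordK ac cP)).
  by rewrite tcoord_linear !RmE tcoord_linear curv_form_linear.
have calIE v := calI_eq0 (@inner_linear _ _ _ g _) (@inner_sym _ _ _ g _)
  (@inner_pos _ _ _ g _) (plane_space P) (linJ v).
split=> [pg v w vA wA|pg v vP].
  have tv := tvecK ac cP v; have tw := tvecK ac cP w.
  rewrite -tv -tw -RmE -mA; apply: (calIE _).1; last by rewrite mA tw.
  by apply: pg; rewrite mA tv.
by apply/calIE => w wP; rewrite mA RmE; apply: pg; rewrite -mA.
Qed.

End Frames.

(** * Normalised frames: compactness of the Grassmannian *)

Section NormalisedFrames.
Context {R : realType} {k n : nat}.
Implicit Types (A : 'M[R]_(k, n)) (f : {ffun 'I_k -> 'I_n}).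

(** The columns f 0, ..., f (k - 1) form the identity matrix: this is an affine
    chart of the Grassmannian, of which only the unit cube is kept. *)
Definition normalised f A : Prop :=
  colsub f A = 1%:M /\ forall i j, `|A i j| <= 1.

Lemma normalised_row_free f A : normalised f A -> row_free A.
Proof.
move=> [A1 _]; apply/row_freeP; exists (colsub f 1%:M).
by rewrite mulmx_colsub mulmx1.
Qed.

Lemma det_replace_col (i : 'I_k) (v : 'I_k -> R) :
  \det (\matrix_(r, t) if t == i then v r else (r == t)%:R) = v i.
Proof.
set B := \matrix_(_, _) _; rewrite (expand_det_row _ i) (bigD1 i)//= big1 ?addr0.
  rewrite mxE eqxx /cofactor -signr_odd addnn odd_double expr0 mul1r.
  rewrite (_ : row' _ _ = 1%:M) ?det1 ?mulr1//.
  apply/matrixP => a b; rewrite !mxE [lift i b == i]eq_sym (negPf (neq_lift i b)).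
  by rewrite (inj_eq (@lift_inj _ i)).
by move=> t ti; rewrite mxE (negPf ti) eq_sym (negPf ti) mul0r.
Qed.

(** The columns f are those of a k x k minor of largest absolute value, and A is
    divided by that submatrix.  Afterwards the minor of f is 1, and the entry
    (i, j) is the minor of the columns f with column i replaced by column j, hence
    at most 1 in absolute value. *)
Lemma normalise A : row_free A ->
  exists2 B, B \in unitmx & exists f, normalised f (B *m A).
Proof.
move=> fA.
have [f0 f0U] : exists f, colsub f A \in unitmx.
  have fT : row_full A^T by rewrite /row_full mxrank_tr.
  exists [ffun i => fullrankfun fT i].
  rewrite -unitmx_tr -row_full_unit.
  rewrite (_ : _^T = rowsub (fullrankfun fT) A^T) ?fullrowsub_full//.
  by apply/matrixP => i j; rewrite !mxE ffunE.
pose D f := `|\det (colsub f A)|.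
have := @Order.TotalTheory.arg_maxP _ _ {ffun 'I_k -> 'I_n} f0 xpredT D isT.
set f := [arg max_(_ > _) _]%O; move=> [f' _ max_f'].
pose B := invmx (colsub f' A).
have f'U : colsub f' A \in unitmx.
  rewrite unitmxE unitfE -normr_gt0; apply: lt_le_trans (max_f' f0 isT).
  by rewrite normr_gt0 -unitfE -unitmxE.
exists B; first by rewrite unitmx_inv.
exists f'; split; first by rewrite -mulmx_colsub mulVmx.
move=> i j; set C := B *m A.
have C1 : colsub f' C = 1%:M by rewrite -mulmx_colsub mulVmx.
pose h := [ffun t => if t == i then j else f' t].
have hE : colsub h C = \matrix_(r, t) if t == i then C r j else (r == t)%:R.
  apply/matrixP => r t; rewrite !mxE ffunE; case: eqP => // _.
  by have /matrixP/(_ r t) := C1; rewrite mxE [RHS]mxE => <-; rewrite /C mxE.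
have := det_replace_col i (fun r => C r j); rewrite -hE => <-.
rewrite -mulmx_colsub det_mulmx det_inv normrM normfV.
by rewrite mulrC ler_pdivrMr ?mul1r ?normr_gt0 -?unitfE -?unitmxE//; exact: max_f'.
Qed.

Lemma mxvec_index_inj (i i' : 'I_k) (j j' : 'I_n) :
  mxvec_index i j = mxvec_index i' j' -> i = i' /\ j = j'.
Proof. by move=> /cast_ord_inj/enum_rank_inj[]. Qed.

Lemma vec_mx_continuous : continuous (@vec_mx R k n).
Proof.
move=> v B [P /= vP PB].
exists (fun _ a => [set y | forall i j, a = mxvec_index i j -> P i j y]).
  move=> r a /=; case/mxvec_indexP: a => i j; rewrite (ord1 r).
  have := vP i j; rewrite mxE; apply: filterS => y Py i' j'.
  by move=> /mxvec_index_inj[<- <-].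
by move=> w Pw; apply: PB => i j; rewrite mxE; exact: (Pw 0 (mxvec_index i j)).
Qed.

Lemma normalised_compact f : compact [set A | normalised f A].
Proof.
pose K := [set v : 'rV[R]_(k * n) | forall i, `[(-1), 1]%classic (v ord0 i)].
have cK : compact K by apply: (@rV_compact _ _ (fun=> _)) => _; exact: segment_compact.
have cK' : compact (vec_mx @` K).
  by apply: continuous_compact => //; apply: continuous_subspaceT; exact: vec_mx_continuous.
apply: subclosed_compact cK' _.
  rewrite (_ : mkset _ = [set A : 'M[R]_(k, n) | colsub f A = 1%:M] `&`
    [set A : 'M[R]_(k, n) | forall i j, `|A i j| <= 1]); last first.
    by apply/seteqP; split=> A [].
  apply: closedI.
    have -> : [set A | colsub f A = 1%:M] = \bigcap_(ij in [set: 'I_k * 'I_k])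
        ((fun A => A ij.1 (f ij.2)) @^-1` [set (ij.1 == ij.2)%:R]).
      apply/seteqP; split=> [A /matrixP A1 [i j] _ /=|A A1 /=].
        by have := A1 i j; rewrite !mxE.
      by apply/matrixP => i j; rewrite !mxE; exact: (A1 (i, j)).
    apply: closed_bigI => ij _; apply: closed_comp; last exact: closed_eq.
    move=> A _; exact: coord_continuous.
  have -> : [set A : 'M[R]_(k, n) | forall i j, `|A i j| <= 1] =
      \bigcap_(ij in [set: 'I_k * 'I_n])
        ((fun A => A ij.1 ij.2) @^-1` [set x | `|x| <= 1]).
    apply/seteqP; split=> [A A1 [i j] _ //=|A A1 i j].
    by exact: (A1 (i, j)).
  apply: closed_bigI => ij _; apply: closed_comp.
    by move=> A _; exact: coord_continuous.
  rewrite (_ : mkset _ = (fun x : R => `|x|) @^-1` [set x | x <= 1])//.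
  by apply: closed_comp; [move=> x _; exact: norm_continuous|exact: closed_le].
move=> A [_ A1]; exists (mxvec A); last exact: mxvecK.
move=> i /=; rewrite in_itv /= -ler_norml.
by case/mxvec_indexP: i => a b; rewrite mxvecE.
Qed.

End NormalisedFrames.

(** * Stability and the conclusion *)

Section Family.
Context {R : realType} {n : nat} {M : manifold R n}.
Context (g : R -> metric M) (Rm : R -> tensor13 M).
Context (g_smooth : smooth_family g).
Context (Rm_curv : forall s : R, 0 <= s -> curvature_tensor (g s) (Rm s)).

(** The neighbourhoods of (0, x0) in [0, +oo[ x R^n, the domain on which the
    family of metrics is smooth. *)
Definition half_nbhs (x0 : 'rV[R]_n) : set_system (R * 'rV[R]_n) :=
  within [set z : R * 'rV[R]_n | 0 <= z.1] (nbhs ((0 : R), x0)).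

#[local] Instance half_nbhs_filter x0 : Filter (half_nbhs x0).
Proof. exact: within_filter. Qed.

(** The conclusion of the theorem for the plane over x with frame A, where
    z = (s, x). *)
Definition free_at k (c : chart R n M) (z : R * 'rV[R]_n) (A : 'M[R]_(k, n)) : Prop :=
  0 < z.1 -> forall Q : plane M k, chart_dom c (foot Q) -> c (foot Q) = z.2 ->
    frame c Q A -> ~ partially_geodesic (g z.1) (Rm z.1) Q.

(** If R(w0, v0) v0 leaves the row space of A0, so does R(w, v) v for the vectors v
    and w with the same coefficients with respect to a nearby frame, because the
    Gram determinant of the frame enlarged by R(w, v) v depends continuously on
    the frame and on (s, x). *)
Lemma not_geodesic_stable k (c : chart R n M) x0 (A0 : 'M[R]_(k, n)) v0 w0 :
  atlas c -> chart_codom c x0 -> row_free A0 ->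
  (v0 <= A0)%MS -> (w0 <= A0)%MS ->
  ~~ (curv_form (gram (g 0) c) x0 w0 v0 v0 <= A0)%MS ->
  \forall A \near A0 & z \near half_nbhs x0, free_at c z A.
Proof.
move=> ac cx0 fA0 /submxP[a ->] /submxP[b ->] yA.
pose N (t : 'M[R]_(k, n) * (R * 'rV[R]_n)) := col_mx t.1
  (curv_form (gram (g t.2.1) c) t.2.2 (b *m t.1) (a *m t.1) (a *m t.1)).
pose N0 := col_mx A0 (curv_form (gram (g 0) c) x0 (b *m A0) (a *m A0) (a *m A0)).
have FF : Filter (filter_prod (nbhs A0) (half_nbhs x0)).
  exact: filter_prod_filter.
have A_cvg : mx_cvg (filter_prod (nbhs A0) (half_nbhs x0)) fst A0.
  move=> i j; apply: (@cvg_comp _ _ _ fst (fun A : 'M[R]_(k, n) => A i j) _ (nbhs A0)).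
    exact: cvg_fst.
  exact: coord_continuous.
have N_cvg : mx_cvg (filter_prod (nbhs A0) (half_nbhs x0)) N N0.
  apply: mx_cvg_col => //; apply: mx_cvg_curv_form.
  - move=> l i j m.
    apply: (@cvg_comp _ _ _ snd (fun z => riemann (gram (g z.1) c) l i j m z.2) _
      (half_nbhs x0)); first exact: cvg_snd.
    apply: (cvg_riemann (@chart_codom_open _ _ _ c) (G := fun s => gram (g s) c)) => //.
      exact: g_smooth.
    exact: gram_unit.
  - by apply: mx_cvg_mul => //; exact: mx_cvg_cst.
  - by apply: mx_cvg_mul => //; exact: mx_cvg_cst.
  - by apply: mx_cvg_mul => //; exact: mx_cvg_cst.
have fN0 : row_free N0 by rewrite row_free_col_mx.
have dN0 : \det (N0 *m N0^T) != 0 by rewrite -row_free_gram.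
have := cvgr_neq0 _ (@mx_cvg_det _ _ _ FF _ _ _
  (@mx_cvg_mul _ _ _ FF _ _ _ _ _ _ _ N_cvg (mx_cvg_tr N_cvg))) dN0.
move=> /(_ FF); apply: filterS => -[A [s x]] /=; rewrite -row_free_gram => fN s0 Q cQ xQ fQ.
have fA := frame_row_free ac cQ fQ.
move=> /(partially_geodesicP (Rm_curv (ltW s0)) ac cQ fQ).
move=> /(_ (a *m A) (b *m A) (submxMl _ _) (submxMl _ _)).
by rewrite xQ; apply/negP; move: fN; rewrite row_free_col_mx.
Qed.

Lemma near_half_nbhs (c : chart R n M) p0 (P : R * 'rV[R]_n -> Prop) :
  chart_dom c p0 -> (\forall z \near half_nbhs (c p0), P z) ->
  \forall p \near p0 & s \near 0^'+, P (s, c p).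
Proof.
move=> cp0 [[U V] /= [U0 Vx] UV].
exists (c @^-1` V, [set s | 0 <= s] `&` U) => /=.
  split; first exact: (chart_fun_cts cp0).
  apply: filterI; last exact: cvg_at_right_filter U0.
  by apply: filterS (nbhs_right_gt 0) => s /ltW.
by move=> [p s] /= [Vp [s0 Us]]; exact: (UV (s, c p)).
Qed.

(** Compactness along the fibre: it is enough to treat the neighbourhood of each
    plane over p0. *)
Lemma no_geodesic_near k p0 :
  (forall (c : chart R n M) (P : plane M k) A, atlas c -> chart_dom c (foot P) ->
    foot P = p0 -> frame c P A ->
    \forall B \near A & z \near half_nbhs (c p0), free_at c z B) ->
  \forall p \near p0 & s \near 0^'+, forall P : plane M k, foot P = p ->
    ~ partially_geodesic (g s) (Rm s) P.
Proof.
move=> H; have [ac cp0] := chart_atP p0; set c := chart_at p0 in ac cp0.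
have Hf (f : {ffun 'I_k -> 'I_n}) :
    \forall z \near half_nbhs (c p0), [set A | normalised f A] `<=` free_at c z.
  have /compact_near_coveringP := @normalised_compact R k n f; apply => A nA.
  have [P Pp0 fP] := plane_of_frame ac cp0 (normalised_row_free nA).
  by apply: (H c P) => //; rewrite Pp0.
have {}Hf : \forall z \near half_nbhs (c p0), forall f : {ffun 'I_k -> 'I_n},
    [set A | normalised f A] `<=` free_at c z.
  exact: (@filter_forall _ _ _ (half_nbhs (c p0)) _ Hf).
have := near_half_nbhs cp0 Hf.
have dp : \forall p \near p0 & s \near 0^'+, chart_dom c p /\ (0 : R) < s.
  exists (chart_dom c, [set s | 0 < s]); last by case.
  split=> /=; first by apply: open_nbhs_nbhs; split=> //; exact: chart_dom_open.
  exact: nbhs_right_gt.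
apply: filterS2 dp => -[p s] /= [cp s0] Hz P Pp.
have cP : chart_dom c (foot P) by rewrite Pp.
have [A fA] := frame_of_plane ac cP.
have [B uB [f nf]] := normalise (frame_row_free ac cP fA).
apply: (Hz f _ nf s0 P cP) => /=; first by rewrite Pp.
exact: frame_mul.
Qed.

Lemma plane_open_near k (U : set (plane M k)) (c : chart R n M) (P : plane M k) A :
  nbhs P U -> atlas c -> chart_dom c (foot P) -> frame c P A ->
  \forall B \near A & z \near half_nbhs (c (foot P)), forall Q,
    chart_dom c (foot Q) -> c (foot Q) = z.2 -> frame c Q B -> U Q.
Proof.
rewrite nbhsE => -[D [oD DP] DU] ac cP fA.
have [[V W] /= [VP WA] VW] : \forall xB \near (c (foot P), A), forall Q,
    chart_dom c (foot Q) -> c (foot Q) = xB.1 -> frame c Q xB.2 -> D Q.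
  exact: (oD : plane_open D).
exists (W, snd @^-1` V) => /=.
  split=> //; apply: cvg_within; exact: cvg_snd.
move=> [B z] /= [WB Vz] Q cQ zQ fQ; apply: DU.
exact: (VW (z.2, B)).
Qed.

End Family.

Theorem lemmaD (R : realType) (n l : nat) (M : manifold R n)
    (g : R -> metric M) (Rm : R -> tensor13 M)
    (c s0 : R) (U0 : set (plane M l))
    (n_ge4 : (4 <= n)%N) (l_bounds : (2 <= l <= n.-1)%N)
    (M_compact : compact [set: M]) (M_connected : connected [set: M])
    (g_smooth : smooth_family g)
    (Rm_curv : forall s : R, 0 <= s -> curvature_tensor (g s) (Rm s))
    (no_larger : forall k, (l.+1 <= k <= n.-1)%N ->
      forall P : plane M k, ~ partially_geodesic (g 0) (Rm 0) P)
    (c_gt0 : 0 < c) (s0_gt0 : 0 < s0)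
    (U0_nbhd : set_nbhs
       [set P : plane M l | partially_geodesic (g 0) (Rm 0) P] U0)
    (calI_gt : forall P : plane M l, U0 P -> forall s : R, 0 < s < s0 ->
      exists v : tangent (foot P),
        [/\ v \in plane_space P, inner (g 0) v v = 1 &
            c * s < calI (@inner _ _ _ (g s) (foot P)) (jacobi (Rm s) v)
                      (plane_space P)]) :
  \forall s \near 0^'+, forall k, (l <= k <= n.-1)%N ->
    forall P : plane M k, ~ partially_geodesic (g s) (Rm s) P.
Proof.
suff Hk k : (l <= k <= n.-1)%N -> \forall s \near 0^'+, forall P : plane M k,
    ~ partially_geodesic (g s) (Rm s) P.
  have : \forall s \near 0^'+, forall k : 'I_n, (l <= k <= n.-1)%N ->
      forall P : plane M k, ~ partially_geodesic (g s) (Rm s) P.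
    apply: (@filter_forall _ _ _ (0^'+ : set_system R) _) => k.
    have [/Hk|_] := boolP (l <= k <= n.-1)%N; first by apply: filterS => s ? _.
    exact: nearW.
  apply: filterS => s H k klb; have kn : (k < n)%N.
    by case/andP: klb => _; case: (n) n_ge4.
  exact: (H (Ordinal kn)).
move=> klb.
suff /(_ M_compact) : compact [set: M] -> \forall s \near 0^'+,
    [set: M] `<=` (fun p => forall P : plane M k, foot P = p ->
      ~ partially_geodesic (g s) (Rm s) P).
  by apply: filterS => s H P; exact: (H (foot P)).
move=> /compact_near_coveringP; apply => p0 _; apply: no_geodesic_near => //.
move=> d P A ac cP <- fA {p0}.
have fr := frame_row_free ac cP fA.
have [pgP|npgP] := pselect (partially_geodesic (g 0) (Rm 0) P); last first.
  have /existsNP[v /existsNP[w /not_implyP[vA /not_implyP[wA /negP yA]]]] :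
      ~ forall v w : 'rV[R]_n, (v <= A)%MS -> (w <= A)%MS ->
        (curv_form (gram (g 0) d) (d (foot P)) w v v <= A)%MS.
    by move=> h; apply/npgP/(partially_geodesicP (Rm_curv 0 (lexx 0)) ac cP fA).
  exact: (not_geodesic_stable g_smooth Rm_curv ac (chart_funP cP) fr vA wA yA).
have [kl|lk] : k = l \/ (l < k)%N.
    by case/andP: klb; rewrite leq_eqVlt => /orP[/eqP->|]; [left|right].
  subst k; have := plane_open_near (U0_nbhd P pgP) ac cP fA.
  have small : \forall B \near A & z \near half_nbhs (d (foot P)), z.1 < s0.
    exists (setT, [set z | z.1 < s0]) => /=; last by move=> [B z] [].
    split; first exact: filterT.
    apply: cvg_within.
    have : \forall z \near ((0 : R), d (foot P)), z.1 < s0.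
      apply: (@cvgr_lt R _ (nbhs ((0 : R), d (foot P))) _ fst (0 : R)) => //.
      exact: cvg_fst.
    by [].
  apply: filterS2 small => -[B z] /= zs0 HU z0 Q cQ zQ fQ pgQ.
  have [|v [vQ _]] := calI_gt Q (HU Q cQ zQ fQ) z.1; first by rewrite z0.
  by rewrite (pgQ v vQ) ltNge mulr_ge0// ltW.
by case: (no_larger k _ P pgP); rewrite lk; case/andP: klb.
Qed.
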